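(* Let $X$ be a topological space and $\varphi\colon\mathbb{R}^+\times X\to X$ a semi-flow. Every closed attracting block $U$ for $\varphi$ is a regular closed set (hence the set of closed attracting blocks of $\varphi$ coincides with the set of regular closed attracting blocks of $\varphi$). Moreover, for all closed attracting blocks $U,U'$ of $\varphi$ one has $$U\wedge U'=U\cap U',$$ where $U\wedge U'=\mathrm{cl}\,\mathrm{int}(U\cap U')$ is the meet in the Boolean algebra of regular closed sets of $X$.
   Context: A semi-flow on $X$ is a continuous map $\varphi\colon\mathbb{R}^+\times X\to X$, $\mathbb{R}^+=[0,\infty)$, with $\varphi(0,x)=x$ and $\varphi(t,\varphi(s,x))=\varphi(t+s,x)$. A closed attracting block is a closed set $U\subset X$ with $\varphi(t,U)\subset\mathrm{int}\,U$ for all $t>0$. A set $U\subset X$ is regular closed if $\mathrm{cl}\,\mathrm{int}\,U=U$. A regular closed attracting block is a regular closed set $U$ with $\varphi(t,U)\subset\mathrm{int}\,U$ for all $t>0$. *)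

(* Defs.v *)
From mathcomp Require Import all_boot all_order all_algebra.
From mathcomp Require Import all_classical all_reals all_analysis.
Set Implicit Arguments.
Unset Strict Implicit.
Unset Printing Implicit Defensive.
Import Order.TTheory GRing.Theory Num.Theory.
Import numFieldNormedType.Exports.
Local Open Scope classical_set_scope.
Local Open Scope ring_scope.

(* A semi-flow is a map on [0, +oo[ `*` X; here it is represented by a function
   on R * X whose values at negative times are irrelevant: continuity is that of
   the restriction to [0, +oo[ `*` X with the subspace topology of R * X, which
   is the product topology of [0, +oo[ and X. *)
Definition semiflow (R : realType) (X : topologicalType) (phi : R * X -> X) :
    Prop :=
  [/\ {within `[0, +oo[ `*` [set: X], continuous phi},
      forall x, phi (0, x) = x
    & forall t s x, 0 <= t -> 0 <= s -> phi (t, phi (s, x)) = phi (t + s, x)].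

Definition closed_attracting_block (R : realType) (X : topologicalType)
    (phi : R * X -> X) (U : set X) : Prop :=
  closed U /\ forall t, 0 < t -> [set phi (t, x) | x in U] `<=` U°.

Definition regclosed_attracting_block (R : realType) (X : topologicalType)
    (phi : R * X -> X) (U : set X) : Prop :=
  regclosed U /\ forall t, 0 < t -> [set phi (t, x) | x in U] `<=` U°.

Definition regclosed_meet (X : topologicalType) (U V : set X) : set X :=
  closure (U `&` V)°.

(* By the next two lemmas, regclosed_meet is the greatest lower bound for
   inclusion among regular closed sets, i.e. the meet of their Boolean
   algebra. *)
Lemma regclosed_regclosed_meet (X : topologicalType) (U V : set X) :
  regclosed (regclosed_meet U V).
Proof. exact/closure_open_regclosed/open_interior. Qed.

Lemma sub_regclosed_meet (X : topologicalType) (U V W : set X) :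
    regclosed U -> regclosed V -> regclosed W ->
  W `<=` regclosed_meet U V <-> W `<=` U /\ W `<=` V.
Proof.
move=> rU rV rW; split => [WUV|[WU WV]].
  split; apply: (subset_trans WUV).
    by rewrite -[X in _ `<=` X]rU; apply/closure_subset/interiorS => x [].
  by rewrite -[X in _ `<=` X]rV; apply/closure_subset/interiorS => x [].
rewrite -[W]rW; apply/closure_subset/interiorS => x Wx.
by split; [exact: WU | exact: WV].
Qed.

(* Main.v *)
Require Import Defs.
From mathcomp Require Import all_boot all_order all_algebra.
From mathcomp Require Import all_classical all_reals all_analysis.
Import Order.TTheory GRing.Theory Num.Theory.
Import numFieldNormedType.Exports.
Local Open Scope classical_set_scope.
Local Open Scope ring_scope.

(* A point x of an attracting block U is the limit of phi (t, x) as t tends to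
   0 from the right, and these points lie in the interior of U; hence U is the
   closure of its interior. As closed attracting blocks are stable under
   intersection, this applies to the intersection of two of them. *)

Lemma semiflow_cvg_at_right0 (R : realType) (X : topologicalType)
    (phi : R * X -> X) (x : X) :
  semiflow phi -> phi (t, x) @[t --> 0^'+] --> x.
Proof.
case=> phi_cont phi0 _ B Bx.
have Dx : (`[0, +oo[ `*` [set: X]) ((0 : R), x).
  by split => //=; rewrite in_itv/= lexx.
(* Continuity at [(0, x)] is only relative to the domain, so the preimage of [B] is a neighbourhood
   only up to points of negative time; the implication accounts for this. *)
have : nbhs ((0 : R), x)
    [set p | (`[0, +oo[ `*` [set: X]) p -> B (phi p)].
  have /subspace_continuousP/(_ _ Dx) := phi_cont.
  by apply; rewrite /from_subspace phi0.
case=> -[V W] /= [V0 Wx] VWB.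
suff : \forall t \near (0 : R)^'+, B (phi (t, x)) by [].
near=> t.
have VWt : (V `*` W) (t, x).
  split => /=; last exact: nbhs_singleton.
  by near: t; exact: cvg_within.
apply: (VWB _ VWt); split => //=; rewrite in_itv/= andbT.
by near: t; exact: nbhs_right_ge.
Unshelve. all: by end_near. Qed.

Lemma closed_attracting_block_regclosed (R : realType) (X : topologicalType)
    (phi : R * X -> X) (U : set X) :
  semiflow phi -> closed_attracting_block phi U -> regclosed U.
Proof.
move=> hphi [cU aU]; rewrite /regclosed eqEsubset; split.
  by have := closureS (@interior_subset _ U); rewrite -((closure_id U).1 cU).
move=> x Ux B Bx.
have Bphi : \forall t \near (0 : R)^'+, B (phi (t, x)).
  exact: semiflow_cvg_at_right0 hphi _ Bx.
(* The filter [0^'+] is proper, so some [t > 0] sends [x] into [B]. As [t > 0], the point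
   [phi (t, x)] also lies in [U°], so [B] meets [U°]. *)
have [t [t0 Bt]] := filter_ex (filterI (nbhs_right_gt (0 : R)) Bphi).
by exists (phi (t, x)); split => //; apply: (aU t t0); exists x.
Qed.

Lemma closed_attracting_blockI (R : realType) (X : topologicalType)
    (phi : R * X -> X) (U V : set X) :
  closed_attracting_block phi U -> closed_attracting_block phi V ->
  closed_attracting_block phi (U `&` V).
Proof.
move=> [cU aU] [cV aV]; split; first exact: closedI.
move=> t t0 _ [x [Ux Vx] <-]; rewrite interiorI.
by split; [apply: (aU t t0) | apply: (aV t t0)]; exists x.
Qed.

Theorem theorem3p23 (R : realType) (X : topologicalType) (phi : R * X -> X)
    (hphi : semiflow phi) :
  [/\ forall U : set X, closed_attracting_block phi U -> regclosed U,
      [set U : set X | closed_attracting_block phi U] =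
        [set U : set X | regclosed_attracting_block phi U]
    & forall U U' : set X,
        closed_attracting_block phi U -> closed_attracting_block phi U' ->
        regclosed_meet U U' = U `&` U'].
Proof.
split.
- by move=> U; exact: closed_attracting_block_regclosed.
- rewrite eqEsubset; split => U [rU aU]; split => //.
    exact: (closed_attracting_block_regclosed _ _ _ _ hphi (conj rU aU)).
  (* In this inclusion [rU] is the equation [closure U° = U], which exhibits [U] as a closure. *)
  by rewrite -rU; exact: closed_closure.
- move=> U V bU bV.
  (* After unfolding, the goal is exactly regular closedness of the intersection of [U] and [V]. *)
  apply: (closed_attracting_block_regclosed _ _ _ _ hphi).
  exact: closed_attracting_blockI.
Qed.
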